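(* Let $\Gamma=(V,E)$ be a connected simple graph of order $n$. Then: (i) $\gamma_{\hat{o}}(\Gamma)\le \left\lfloor\frac{n+\gamma_2(\Gamma)}{2}\right\rfloor$, where $\gamma_2(\Gamma)$ denotes the $2$-domination number of $\Gamma$. If, moreover, the minimum degree of $\Gamma$ is greater than or equal to two, then: (ii) $\gamma_{\hat{o}}(\Gamma)\le n-\alpha(\Gamma)$, where $\alpha(\Gamma)$ denotes the independence number of $\Gamma$; (iii) $\gamma_{\hat{o}}(\Gamma)\le \left\lfloor\frac{5n}{6}\right\rfloor$; (iv) if $\Gamma$ is a cubic graph, then $\gamma_{\hat{o}}(\Gamma)\le \left\lfloor\frac{3n}{4}\right\rfloor$. Here $\gamma_{\hat{o}}(\Gamma)$ is the global strong offensive alliance number of $\Gamma$.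
   Context: Graphs are finite and simple. For $S\subseteq V$ and $v\in V$, $N_S(v)$ is the set of neighbors of $v$ lying in $S$ and $N_{V\setminus S}(v)$ is the set of neighbors of $v$ lying in $V\setminus S$. A non-empty set $S\subseteq V$ (with $S=V$ allowed) is a global strong offensive alliance in $\Gamma$ if $|N_S(v)|\ge |N_{V\setminus S}(v)|+2$ for every $v\in V\setminus S$. The global strong offensive alliance number $\gamma_{\hat{o}}(\Gamma)$ is the minimum cardinality of a global strong offensive alliance in $\Gamma$. The $2$-domination number $\gamma_2(\Gamma)$ is the minimum cardinality of a set $H\subseteq V$ such that every vertex of $V\setminus H$ has at least two neighbors in $H$. A cubic graph is a $3$-regular graph. *)

(* Defs.v *)
(* A finite simple graph is a symmetric irreflexive relation [e : rel V] on a
   finite type [V] of vertices. *)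
From HB Require Import structures.
From mathcomp Require Import all_boot.

Set Implicit Arguments.
Unset Strict Implicit.
Unset Printing Implicit Defensive.

Definition nbrs_in (V : finType) (e : rel V) (S : {set V}) (v : V) : {set V} :=
  [set u in S | e v u].

Definition degree (V : finType) (e : rel V) (v : V) : nat :=
  #|nbrs_in e [set: V] v|.

(* The default value [#|V|] exceeds every degree (see [min_degreeP]), so it only
   matters on the empty graph. *)
Definition min_degree (V : finType) (e : rel V) : nat :=
  \big[minn/#|V|]_(v : V) degree e v.

Definition regular (V : finType) (e : rel V) (k : nat) : Prop :=
  forall v : V, degree e v = k.

Definition cubic (V : finType) (e : rel V) : Prop := regular e 3.

(* The graph without vertices is not considered connected. *)
Definition connected_graph (V : finType) (e : rel V) : Prop :=
  0 < #|V| /\ forall x y : V, connect e x y.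

Definition independent (V : finType) (e : rel V) (S : {set V}) : bool :=
  [forall x in S, forall y in S, ~~ e x y].

Definition independence_number (V : finType) (e : rel V) : nat :=
  \max_(S : {set V} | independent e S) #|S|.

Definition two_dominating (V : finType) (e : rel V) (H : {set V}) : bool :=
  [forall v in ~: H, 2 <= #|nbrs_in e H v|].

Definition global_strong_offensive_alliance
    (V : finType) (e : rel V) (S : {set V}) : bool :=
  (S != set0) && [forall v in ~: S, #|nbrs_in e (~: S) v| + 2 <= #|nbrs_in e S v|].

(* In both minima [[set: V]] is the witness that the range is inhabited; for
   alliances this requires a vertex, cf. [gsoa_setT]. *)
Definition two_domination_number (V : finType) (e : rel V) : nat :=
  #|[arg min_(H < [set: V] | two_dominating e H) #|H|]|.

Definition gsoa_number (V : finType) (e : rel V) : nat :=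
  #|[arg min_(S < [set: V] | global_strong_offensive_alliance e S) #|S|]|.

Lemma min_degreeP (V : finType) (e : rel V) : irreflexive e -> 0 < #|V| ->
  (exists v, degree e v = min_degree e) /\ (forall v, min_degree e <= degree e v).
Proof.
move=> e_irr /card_gt0P[v0 _].
have le_min v : min_degree e <= degree e v.
  rewrite /min_degree; have: v \in index_enum V by rewrite mem_index_enum.
  elim: (index_enum V) => //= u s IHs; rewrite inE big_cons geq_min.
  by case/orP=> [/eqP-> | /IHs->]; rewrite ?leqnn ?orbT.
have lt_deg v : degree e v < #|V|.
  rewrite -[#|V|]cardsT; apply: proper_card; apply/properP.
  by split; [exact: subsetT | exists v; rewrite ?inE ?e_irr].
split=> //.
have [eqV | //] : min_degree e = #|V| \/ exists v, degree e v = min_degree e.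
  rewrite /min_degree; elim/big_ind: _ => [|x y IHx IHy|v _]; first by left.
    by rewrite /minn; case: ifP.
  by right; exists v.
by have := leq_ltn_trans (le_min v0) (lt_deg v0); rewrite eqV ltnn.
Qed.

Lemma two_dominating_setT (V : finType) (e : rel V) :
  two_dominating e [set: V].
Proof. by apply/forall_inP => v; rewrite !inE. Qed.

Lemma gsoa_setT (V : finType) (e : rel V) : 0 < #|V| ->
  global_strong_offensive_alliance e [set: V].
Proof.
move=> V_gt0; apply/andP; split; first by rewrite -card_gt0 cardsT.
by apply/forall_inP => v; rewrite !inE.
Qed.

Lemma two_domination_numberP (V : finType) (e : rel V) :
  (exists2 H, two_dominating e H & #|H| = two_domination_number e) /\
  (forall H, two_dominating e H -> two_domination_number e <= #|H|).
Proof.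
rewrite /two_domination_number.
by case: arg_minnP => [|H domH minH]; [exact: two_dominating_setT | split=> //; exists H].
Qed.

Lemma gsoa_numberP (V : finType) (e : rel V) : 0 < #|V| ->
  (exists2 S, global_strong_offensive_alliance e S & #|S| = gsoa_number e) /\
  (forall S, global_strong_offensive_alliance e S -> gsoa_number e <= #|S|).
Proof.
move=> V_gt0; rewrite /gsoa_number.
by case: arg_minnP => [|S allS minS]; [exact: gsoa_setT | split=> //; exists S].
Qed.

(* Main.v *)
(* A partition of a vertex set A into k classes with the fewest monochromatic
   edges leaves each vertex with at most a 1/k fraction of its A-neighbors in its
   own class, and the largest class B has at least |A|/k vertices.  Complements
   of such classes are the required sets: k = 2 with A the complement of a minimum
   2-dominating set gives (i); A = V with k = 3 (minimum degree at least 2) or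
   k = 2 (cubic) bounds the 2-domination number by 2n/3 or n/2, and (iii) and (iv)
   follow from (i). *)
Require Import Defs.
From HB Require Import structures.
From mathcomp Require Import all_boot.
From mathcomp Require Import zify.

Lemma sum_card_fibers {V C : finType} (f : V -> C) (A : {set V}) :
  \sum_c #|[set u in A | f u == c]| = #|A|.
Proof.
rewrite -sum1_card (partition_big f xpredT) //=; apply: eq_bigr => c _.
by rewrite -sum1_card; apply: eq_bigl => u; rewrite inE.
Qed.

(** The color [c] need not be [f v], so the same count gives the cost of recoloring [v] with [c]. *)
Definition mono_nbrs {V C : finType} (e : rel V) (f : V -> C) (v : V) (c : C) :=
  #|[set u | e v u & f u == c]|.

(** Each monochromatic edge is counted from both ends, so those at [v] contribute twice; the double
    sum does not depend on the color of [v]. *)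
Lemma sum_mono_nbrsD1 {V C : finType} (e : rel V) (f : V -> C) (v : V) :
  symmetric e -> irreflexive e ->
  \sum_x mono_nbrs e f x (f x) =
  \sum_(x | x != v) \sum_(y | y != v) (e x y && (f y == f x))
  + 2 * mono_nbrs e f v (f v).
Proof.
move=> e_sym e_irr.
have monoE x c : mono_nbrs e f x c = \sum_y (e x y && (f y == c)).
  rewrite /mono_nbrs -sum1_card big_mkcond; apply: eq_bigr => y _.
  by rewrite inE; case: (_ && _).
rewrite (bigD1 v) //= addnC mulSn mul1n addnCA addnC; congr (_ + _).
under eq_bigr => x _ do rewrite monoE (bigD1 v) //=.
rewrite big_split /= addnC; congr (_ + _).
rewrite monoE [RHS](bigD1 v) //= e_irr add0n; apply: eq_bigr => x _.
by rewrite e_sym eq_sym.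
Qed.

(** A coloring with the fewest monochromatic edges works: recoloring one vertex affects only the
    edges at that vertex and cannot improve the total. *)
Lemma locally_optimal_coloring {V : finType} (e : rel V) (k : nat) :
  symmetric e -> irreflexive e ->
  exists f : V -> 'I_k.+1,
    forall v c, mono_nbrs e f v (f v) <= mono_nbrs e f v c.
Proof.
move=> e_sym e_irr.
pose M (f : {ffun V -> 'I_k.+1}) := \sum_x mono_nbrs e f x (f x).
case: (@arg_minnP _ [ffun => ord0] xpredT M isT) => f _ minf.
exists f => v c.
pose g : {ffun V -> 'I_k.+1} := [ffun x => if x == v then c else f x].
have gE x : x != v -> g x = f x by rewrite ffunE => /negPf->.
have gvE : mono_nbrs e g v (g v) = mono_nbrs e f v c.
  apply: eq_card => u; rewrite !inE [g v]ffunE eqxx.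
  by case: (eqVneq u v) => [->|/gE->//]; rewrite e_irr.
(* The colorings [f] and [g] agree off [v], so the double sums cancel and twice the desired
   inequality remains. *)
have := minf g isT; rewrite /M !(sum_mono_nbrsD1 _ _ v e_sym e_irr) gvE.
rewrite [X in _ <= X + _ -> _](_ : _ =
  \sum_(x | x != v) \sum_(y | y != v) (e x y && (f y == f x))).
  by rewrite leq_add2l leq_pmul2l.
by apply: eq_bigr => x /gE->; apply: eq_bigr => y /gE->.
Qed.

(** Both bounds average over the [k.+1] colors: a largest class has at least the mean size, and the
    own color of [v] is the rarest among its neighbors in [A]. *)
Lemma large_sparse_subset {V : finType} (e : rel V) (A : {set V}) (k : nat) :
  symmetric e -> irreflexive e ->
  exists B : {set V},
    [/\ B \subset A, #|A| <= k.+1 * #|B|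
      & {in B, forall v, k.+1 * #|nbrs_in e B v| <= #|nbrs_in e A v|}].
Proof.
move=> e_sym e_irr.
(* Edges leaving [A] must not count, so the coloring is optimized for the graph induced on [A]. *)
pose eA : rel V := fun x y => [&& e x y, x \in A & y \in A].
have eA_sym : symmetric eA by move=> x y; rewrite /eA e_sym (andbC (x \in A)).
have eA_irr : irreflexive eA by move=> x; rewrite /eA e_irr.
have [f f_opt] := locally_optimal_coloring eA k eA_sym eA_irr.
pose cls c := [set u in A | f u == c].
have sum_const m : \sum_(c < k.+1) m = k.+1 * m.
  by rewrite big_const_ord iter_addn_0 mulnC.
have [c0 _ maxc0] := @arg_maxnP _ ord0 xpredT (fun c => #|cls c|) isT.
exists (cls c0); split; first by apply/subsetP => u; rewrite inE => /andP[].
  rewrite -(sum_card_fibers f A) -sum_const.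
  by apply: leq_sum => c _; apply: maxc0.
move=> v; rewrite inE => /andP[vA /eqP fv].
have nbrsE c : #|[set u in nbrs_in e A v | f u == c]| = mono_nbrs eA f v c.
  by apply: eq_card => u; rewrite !inE /eA vA /= (andbC (e v u)).
have -> : #|nbrs_in e (cls c0) v| = mono_nbrs eA f v (f v).
  by rewrite -nbrsE; apply: eq_card => u; rewrite !inE fv andbAC.
rewrite -(sum_card_fibers f (nbrs_in e A v)) -sum_const.
by apply: leq_sum => c _; rewrite nbrsE.
Qed.

Lemma card_nbrs_inC {V : finType} (e : rel V) (A : {set V}) (v : V) :
  #|nbrs_in e A v| + #|nbrs_in e (~: A) v| = degree e v.
Proof.
rewrite /degree -[RHS](cardsID A); congr (_ + _);
  by apply: eq_card => u; rewrite !inE ?andbT // andbC.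
Qed.

Lemma setC_gsoa {V : finType} (e : rel V) (B : {set V}) : 0 < #|V| ->
  {in B, forall v, #|nbrs_in e B v| + 2 <= #|nbrs_in e (~: B) v|} ->
  gsoa_number e <= #|V| - #|B|.
Proof.
move=> V_gt0 ltB; rewrite -(cardsC B) addKn.
apply: (gsoa_numberP e V_gt0).2; apply/andP; split.
  (* If the complement were empty, [B] would be all of [V], and the hypothesis would require two
     neighbors in the empty set. *)
  apply/eqP => B0; have /card_gt0P[v _] := V_gt0.
  have /ltB : v \in B by rewrite -[B]setCK B0 setC0 inE.
  have -> : nbrs_in e (~: B) v = set0 by apply/setP => u; rewrite B0 !inE.
  by rewrite cards0 addn2.
by rewrite setCK; apply/forall_inP.
Qed.

Lemma setC_two_dominating {V : finType} (e : rel V) (B : {set V}) :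
  {in B, forall v, 2 <= #|nbrs_in e (~: B) v|} ->
  two_domination_number e <= #|V| - #|B|.
Proof.
move=> leB; rewrite -(cardsC B) addKn.
by apply: (two_domination_numberP e).2; apply/forall_inP; rewrite setCK.
Qed.

Lemma gsoa_le_two_domination {V : finType} (e : rel V) :
  symmetric e -> irreflexive e -> 0 < #|V| ->
  gsoa_number e <= (#|V| + two_domination_number e) %/ 2.
Proof.
move=> e_sym e_irr V_gt0.
have [[H /forall_inP domH <-] _] := two_domination_numberP e.
have [B [sBH leB degB]] := large_sparse_subset e (~: H) 1 e_sym e_irr.
suff : gsoa_number e <= #|V| - #|B| by have := cardsC H; lia.
apply: setC_gsoa => // v vB.
(* Half or more of the neighbors of [v] in [~: H] avoid [B], enough to match those in [B]; the
   neighbors in [H] also avoid [B] and supply the surplus of two. *)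
have := domH v (subsetP sBH v vB); have := degB v vB.
by have := card_nbrs_inC e H v; have := card_nbrs_inC e B v; lia.
Qed.

(** A vertex of an independent set has all its neighbors, at least two, in the complement. *)
Lemma gsoa_le_independence {V : finType} (e : rel V) :
  0 < #|V| -> (forall v, 2 <= degree e v) ->
  gsoa_number e <= #|V| - independence_number e.
Proof.
move=> V_gt0 deg2.
have ind0 : independent e set0 by apply/forall_inP => v; rewrite inE.
rewrite /independence_number (bigmax_eq_arg set0) //.
case: arg_maxnP => // I /forall_inP indI _.
apply: setC_gsoa => // v vI.
have nbrs0 : nbrs_in e I v = set0.
  apply/setP => u; rewrite !inE; apply/andP => -[uI].
  by apply/negP; apply: (forall_inP (indI v vI)).
by have := deg2 v; rewrite -(card_nbrs_inC e I) nbrs0 cards0.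
Qed.

Lemma two_domination_le_min_degree2 {V : finType} (e : rel V) :
  symmetric e -> irreflexive e -> (forall v, 2 <= degree e v) ->
  3 * two_domination_number e <= 2 * #|V|.
Proof.
move=> e_sym e_irr deg2.
have [B [_ leB degB]] := large_sparse_subset e [set: V] 2 e_sym e_irr.
suff : two_domination_number e <= #|V| - #|B| by rewrite cardsT in leB; lia.
(* At least two thirds of the degree goes outside [B]; this is at least 4/3, hence at least 2 by
   integrality. *)
apply: setC_two_dominating => v vB; have := degB v vB.
rewrite -/(degree e v); have := deg2 v; have := card_nbrs_inC e B v; lia.
Qed.

Lemma two_domination_le_cubic {V : finType} (e : rel V) :
  symmetric e -> irreflexive e -> cubic e -> 2 * two_domination_number e <= #|V|.
Proof.
move=> e_sym e_irr deg3.
have [B [_ leB degB]] := large_sparse_subset e [set: V] 1 e_sym e_irr.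
suff : two_domination_number e <= #|V| - #|B| by rewrite cardsT in leB; lia.
(* Half of 3 rounds down to one neighbor inside [B], leaving two outside. *)
apply: setC_two_dominating => v vB; have := degB v vB.
rewrite -/(degree e v); have := deg3 v; have := card_nbrs_inC e B v; lia.
Qed.

Theorem theorem2 (V : finType) (e : rel V)
    (e_sym : symmetric e) (e_irr : irreflexive e) (e_conn : connected_graph e) :
  gsoa_number e <= (#|V| + two_domination_number e) %/ 2 /\
  (2 <= min_degree e ->
   [/\ gsoa_number e <= #|V| - independence_number e,
       gsoa_number e <= (5 * #|V|) %/ 6
     & cubic e -> gsoa_number e <= (3 * #|V|) %/ 4]).
Proof.
have [V_gt0 _] := e_conn.
have le_i := gsoa_le_two_domination e e_sym e_irr V_gt0.
split=> // min2.
have deg2 v : 2 <= degree e v.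
  exact: leq_trans min2 ((min_degreeP e_irr V_gt0).2 v).
split; first exact: gsoa_le_independence.
  by have := two_domination_le_min_degree2 e e_sym e_irr deg2; lia.
by move=> /(two_domination_le_cubic e e_sym e_irr); lia.
Qed.
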